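(* Let $\mathbf{S}\in\mathbb{R}^{N\times N}$ be the symmetric graph matrix description of an undirected graph with $N$ nodes, with distinct eigenvalues $\lambda_1,\dots,\lambda_N$ and eigendecomposition $\mathbf{S}=\mathbf{V}\,\mathrm{diag}(\lambda_1,\dots,\lambda_N)\,\mathbf{V}^{T}$, where $\mathbf{V}$ is orthogonal. Let $\mathbf{y}=\sum_{k=0}^{K}\mathrm{diag}(\mathbf{h}^{(k)})\mathbf{S}^k\mathbf{x}$ be the output, for the input graph signal $\mathbf{x}\in\mathbb{R}^N$, of an arbitrary node-variant graph filter characterized by some filter tap matrix $\mathbf{H}\in\mathbb{R}^{N\times(K+1)}$ with $(k+1)$-th column $\mathbf{h}^{(k)}\in\mathbb{R}^N$, $k=0,\dots,K$. Let $\boldsymbol{\Lambda}\in\mathbb{R}^{N\times(K+1)}$ be the Vandermonde matrix with entries $[\boldsymbol{\Lambda}]_{ik}=\lambda_i^{k-1}$. If the matrix $\mathbf{V}^{T}\big(\mathbf{V}\circ(\mathbf{H}\boldsymbol{\Lambda}^{T})\big)$ is not diagonal, then the output exhibits frequency content that is not present in the input.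
   Context: A graph matrix description of a graph with nodes $v_1,\dots,v_N$ and edge set $\mathcal{E}$ is a matrix $\mathbf{S}\in\mathbb{R}^{N\times N}$ with $[\mathbf{S}]_{ij}=0$ for all distinct $i,j$ such that $(v_j,v_i)\notin\mathcal{E}$. The symbol $\circ$ denotes the elementwise product of matrices, and $\mathrm{diag}(\mathbf{a})$ is the diagonal matrix with the vector $\mathbf{a}$ on its diagonal. The frequency responses (graph Fourier transforms) of the input and output are $\tilde{\mathbf{x}}=\mathbf{V}^{T}\mathbf{x}$ and $\tilde{\mathbf{y}}=\mathbf{V}^{T}\mathbf{y}$; the $i$-th entry of the frequency response of a signal measures how much the $i$-th eigenvector of $\mathbf{S}$ (the $i$-th column of $\mathbf{V}$) contributes to that signal. They are related by $\tilde{\mathbf{y}}=\mathbf{V}^{T}\big(\mathbf{V}\circ(\mathbf{H}\boldsymbol{\Lambda}^{T})\big)\tilde{\mathbf{x}}$. A filter is described as not able to create frequencies when $\tilde x_i=0$ implies $\tilde y_i=0$. *)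

(* Defs.v *)
From mathcomp Require Import all_boot all_order all_algebra.
From mathcomp Require Import reals.
Set Implicit Arguments.
Unset Strict Implicit.
Unset Printing Implicit Defensive.
Import GRing.Theory.
Local Open Scope ring_scope.

(* An edge [E i j] goes from node i to node j; an undirected graph is a
   symmetric [E].  Diagonal entries of S are unconstrained, whether or not the
   graph has loops. *)
Definition graph_matrix_description (R : realType) (N : nat)
    (E : rel 'I_N) (S : 'M[R]_N) : Prop :=
  forall i j : 'I_N, i != j -> ~~ E j i -> S i j = 0.

Definition orthogonal_mx (R : realType) (N : nat) (V : 'M[R]_N) : Prop :=
  V^T *m V = 1%:M /\ V *m V^T = 1%:M.

Definition hadamard (R : realType) (m n : nat) (A B : 'M[R]_(m, n)) :
    'M[R]_(m, n) := map2_mx *%R A B.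

(* The library's [Vandermonde m a] has the points [a] along its columns, so the
   N x (K+1) matrix with (0-based) entries lam_i ^ k is its transpose. *)
Definition Lambda_mx (R : realType) (N K : nat) (lam : 'rV[R]_N) :
    'M[R]_(N, K.+1) := (Vandermonde K.+1 lam)^T.

Definition node_variant_filter (R : realType) (N K : nat)
    (H : 'M[R]_(N, K.+1)) (S : 'M[R]_N) (x : 'cV[R]_N) : 'cV[R]_N :=
  \sum_(k < K.+1) diag_mx (col k H)^T *m (S ^+ k) *m x.

(* Graph Fourier transform; the i-th column of V is the i-th eigenvector. *)
Definition gft (R : realType) (N : nat) (V : 'M[R]_N) (x : 'cV[R]_N) :
    'cV[R]_N := V^T *m x.

(* Negation of "for every input, a zero frequency component of the input is a
   zero frequency component of the output". *)
Definition creates_frequencies (R : realType) (N : nat) (V : 'M[R]_N)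
    (f : 'cV[R]_N -> 'cV[R]_N) : Prop :=
  exists (x : 'cV[R]_N) (i : 'I_N),
    gft V x i 0 = 0 /\ gft V (f x) i 0 <> 0.

(* Main.v *)
(** The input [v_j], the j-th eigenvector, has frequency response [e_j].  Since
    [S^k v_j = lam_j^k v_j], the filter sends it to [v_j o (H Lambda^T)_j], so
    its output has as frequency response the j-th column of
    [V^T (V o (H Lambda^T))]; a nonzero off-diagonal entry (i, j) of this matrix
    is a frequency created at i. *)
Require Import Defs.
From mathcomp Require Import all_boot all_order all_algebra.
From mathcomp Require Import reals.
Import GRing.Theory.
Local Open Scope ring_scope.

Lemma mulmx_col (R : pzSemiRingType) (m n p : nat) (A : 'M[R]_(m, n))
    (B : 'M[R]_(n, p)) (j : 'I_p) :
  A *m col j B = col j (A *m B).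
Proof. by apply/colP=> i; rewrite !mxE; apply: eq_bigr => k _; rewrite mxE. Qed.

Lemma mulmx_exp_eigenvector (R : comPzRingType) (n : nat) (A : 'M[R]_n)
    (a : R) (v : 'cV[R]_n) (k : nat) :
  A *m v = a *: v -> A ^+ k *m v = a ^+ k *: v.
Proof.
move=> Av; elim: k => [|k IHk]; first by rewrite !expr0 mul1mx scale1r.
by rewrite exprSr -mulmxA Av -scalemxAr IHk scalerA -exprS.
Qed.

(** Multiplying the product by all of [V] cancels [V^T *m V] and leaves [V *m diag_mx d], whose
    columns are rescaled columns of [V]. *)
Lemma mulmx_col_eigenbasis (R : comPzRingType) (n : nat) (V : 'M[R]_n)
    (d : 'rV[R]_n) (j : 'I_n) :
  V^T *m V = 1%:M -> (V *m diag_mx d *m V^T) *m col j V = d 0 j *: col j V.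
Proof.
move=> VtV; rewrite mulmx_col -mulmxA VtV mulmx1 mul_mx_diag.
by apply/colP=> i; rewrite !mxE mulrC.
Qed.

Lemma node_variant_filter_eigenvector (R : realType) (N K : nat)
    (H : 'M[R]_(N, K.+1)) (S V : 'M[R]_N) (lam : 'rV[R]_N) (j : 'I_N) :
  S *m col j V = lam 0 j *: col j V ->
  node_variant_filter H S (col j V) =
  col j (hadamard V (H *m (Lambda_mx K lam)^T)).
Proof.
(* At node [i] both sides are [V i j] times the tap polynomial of row [i] of [H] evaluated at
   [lam 0 j]; distributing [V i j] over that sum allows comparison power by power. *)
move=> Sv; apply/colP=> i; rewrite summxE !mxE mulr_sumr.
apply: eq_bigr => k _.
rewrite -mulmxA (mulmx_exp_eigenvector _ _ _ _ _ k Sv) mul_diag_mx !mxE.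
by rewrite [RHS]mulrC mulrA.
Qed.

Theorem corollary2 (R : realType) (N K : nat) (E : rel 'I_N)
    (S V : 'M[R]_N) (lam : 'rV[R]_N) (H : 'M[R]_(N, K.+1))
    (undirE : symmetric E)
    (descS : graph_matrix_description E S)
    (symS : S^T = S)
    (distinct_lam : injective (fun i : 'I_N => lam 0 i))
    (orthV : orthogonal_mx V)
    (eigS : S = V *m diag_mx lam *m V^T)
    (not_diag :
       ~~ is_diag_mx (V^T *m hadamard V (H *m (Lambda_mx K lam)^T))) :
  creates_frequencies V (node_variant_filter H S).
Proof.
have [VtV _] := orthV.
move: not_diag => /forallPn[i /forallPn[j]]; rewrite negb_imply.
case/andP=> neq_ij /eqP Mij_neq0; exists (col j V), i; split.
  (* The input response at [i] is an off-diagonal entry of the identity. [is_diag_mx] compares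
     indices as natural numbers, hence [val_eqE]. *)
  by rewrite /gft mulmx_col VtV !mxE -val_eqE /= (negbTE neq_ij).
have Sv : S *m col j V = lam 0 j *: col j V.
  by rewrite eigS mulmx_col_eigenbasis.
by rewrite (node_variant_filter_eigenvector _ _ _ _ _ _ _ _ Sv) /gft mulmx_col mxE.
Qed.
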